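(* For any integer $r\ge4$, there are infinitely many 4-connected, $r$-regular graphs $H$ of class 1 with $\mathcal{N}^*(H)\ne\emptyset$.
   Context: A graph is of class 1 if its edge chromatic number equals its maximum degree. For a matching-covered graph $H$ (connected, every edge in some perfect matching), $X\subseteq E(H)$ is feasible if there are perfect matchings $M_1,M_2$ of $H$ with $|M_1\cap X|\not\equiv|M_2\cap X|\pmod2$, non-feasible otherwise. $\nabla_H(U)$ is the set of edges with exactly one end in $U$; $X\sim_H Y$ means $X=Y\oplus\nabla_H(U)$ for some $U\subseteq V(H)$. $\mathcal{N}^*(H)$ is the set of non-feasible $X\subseteq E(H)$ with neither $X\sim_H\emptyset$ nor $X\sim_H E(H)$. *)

(* Defs.v *)
From mathcomp Require Import all_boot.

Set Implicit Arguments.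
Unset Strict Implicit.
Unset Printing Implicit Defensive.

Record sgraph := SGraph {
  vertex :> finType;
  adj : rel vertex;
  adj_sym : symmetric adj;
  adj_irrefl : irreflexive adj
}.

Definition isomorphic (G H : sgraph) : Prop :=
  exists2 f : G -> H, bijective f & forall x y : G, adj (f x) (f y) = adj x y.

Section Graph.
Variable G : sgraph.

(* An edge is the two-element set of its ends. *)
Definition edges : {set {set G}} :=
  [set [set p.1; p.2] | p : G * G & adj p.1 p.2].

Definition degree (x : G) : nat := #|[set y | adj x y]|.
Definition max_degree : nat := \max_(x : G) degree x.
Definition regular (r : nat) : bool := [forall x : G, degree x == r].

Definition adj_avoiding (S : {set G}) : rel G :=
  [rel x y | [&& x \notin S, y \notin S & adj x y]].

Definition connected : bool :=
  (0 < #|G|) && [forall x : G, forall y : G, connect (@adj G) x y].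

Definition k_connected (k : nat) : bool :=
  (k < #|G|) &&
  [forall S : {set G}, (#|S| < k) ==>
    [forall x in ~: S, forall y in ~: S, connect (adj_avoiding S) x y]].

(* Colourings are defined on the subtype of edges, so that an edgeless graph
   is 0-colourable. *)
Definition edge_type := {e : {set G} | e \in edges}.

Definition edge_colorable (k : nat) : bool :=
  [exists c : {ffun edge_type -> 'I_k},
    forall e : edge_type, forall f : edge_type,
      (e != f) && (val e :&: val f != set0) ==> (c e != c f)].

Lemma ex_edge_colorable : exists k, edge_colorable k.
Proof.
exists #|{: edge_type}|; apply/existsP.
exists [ffun e => enum_rank e]; apply/forallP=> e; apply/forallP=> f.
by apply/implyP=> /andP[nef _]; rewrite !ffunE (inj_eq enum_rank_inj).
Qed.

Definition edge_chromatic_number : nat := ex_minn ex_edge_colorable.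

Definition class1 : bool := edge_chromatic_number == max_degree.

Definition perfect_matching (M : {set {set G}}) : bool :=
  (M \subset edges) && [forall x : G, #|[set e in M | x \in e]| == 1].

Definition matching_covered : bool :=
  connected && [forall e in edges, exists M, perfect_matching M && (e \in M)].

Definition feasible (X : {set {set G}}) : bool :=
  [exists M1, exists M2, [&& perfect_matching M1, perfect_matching M2
    & #|M1 :&: X| != #|M2 :&: X| %[mod 2]]].

Definition cut (U : {set G}) : {set {set G}} :=
  [set e in edges | #|e :&: U| == 1].

Definition symdiff (X Y : {set {set G}}) : {set {set G}} :=
  (X :\: Y) :|: (Y :\: X).

Definition switching_equiv (X Y : {set {set G}}) : bool :=
  [exists U : {set G}, X == symdiff Y (cut U)].

Definition Nstar : {set {set {set G}}} :=
  [set X : {set {set G}} | [&& X \subset edges, ~~ feasible X,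
     ~~ switching_equiv X set0 & ~~ switching_equiv X edges]].

End Graph.

(* Main.v *)
Require Import Defs.
From mathcomp Require Import all_boot ssralg zmodp.

Set Implicit Arguments.
Unset Strict Implicit.
Unset Printing Implicit Defensive.

Import GRing.Theory.

(* Let m be the odd number among r and r + 1. The complete graph on Z_m plus a
   point, with edge xy coloured x + y and the edge from x to the point coloured
   2x, is 1-factorised by Z_m; when r < m, drop the colour 2. Take n >= m copies
   of this graph, and detach the extra points: the vertex x of the i-th clique is
   attached to the (i + x)-th extra point, i + x in Z_n. The colouring remains a
   1-factorisation, so the graph is r-regular of class 1 and, if connected,
   matching covered.

   The n extra points form a barrier whose removal leaves the n odd cliques, so
   every perfect matching has exactly (m - 1) / 2 edges inside each clique. Hence
   the edge set X of one clique is non-feasible; neither X nor its complement is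
   a cut, as cliques contain triangles.

   For 4-connectivity, place the vertex x of clique i at i + x and the t-th extra
   point at t. At most three places meet a set S of three vertices. The extra
   points at two untouched places at distance 1, 2, 3 or 4 are joined through
   vertices k in {0, 2} and l in {3, 4} of one clique, so those at untouched places
   are all connected outside S, and every vertex outside S reaches one of them. *)

(** * Edges, degrees, perfect matchings and cuts in general graphs *)

Section GraphTheory.
Variable G : sgraph.
Implicit Types (x y : G) (e : {set G}) (M : {set {set G}}).

Lemma edgesP e :
  reflect (exists x y, adj x y /\ e = [set x; y]) (e \in edges G).
Proof.
apply: (iffP imsetP) => [[[x y]]|[x [y [xy ->]]]].
  by rewrite inE /= => xy ->; exists x, y.
by exists (x, y); rewrite ?inE.
Qed.

Lemma edge_neq x y : adj x y -> x != y.
Proof. by apply: contraTneq => ->; rewrite adj_irrefl. Qed.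

Lemma eq_set2 (T : finType) (a b c : T) : a != b ->
  [set a; b] = [set a; c] -> b = c.
Proof.
move=> ab /setP/(_ b); rewrite !inE eqxx orbT => /esym.
by rewrite eq_sym (negPf ab) => /eqP.
Qed.

Lemma mem_edges x y : ([set x; y] \in edges G) = adj x y.
Proof.
apply/edgesP/idP => [[a [b [ab E]]]|xy]; last by exists x, y.
have nab := edge_neq ab.
have: x \in [set a; b] by rewrite -E !inE eqxx.
rewrite !inE => /orP[] /eqP ?; subst x.
  by rewrite -(eq_set2 nab (esym E)).
move: E; rewrite [RHS]setUC => E; rewrite eq_sym in nab.
by rewrite -(eq_set2 nab (esym E)) adj_sym.
Qed.

(** Edges that share the end [x] receive distinct colours. *)
Lemma edge_colorable_degree k x : edge_colorable G k -> degree x <= k.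
Proof.
case/existsP => c /forallP Hc.
have Ne (y : {y | adj x y}) : [set x; val y] \in edges G.
  by rewrite mem_edges (valP y).
pose E (y : {y | adj x y}) : edge_type G := Sub [set x; val y] (Ne y).
suff /leq_card : injective (c \o E) by rewrite card_ord card_sig /degree cardsE.
move=> y z /= cyz; apply/val_inj/eqP/negPn/negP => yz.
have /forallP/(_ (E z)) := Hc (E y); rewrite cyz eqxx implybF negb_and negbK.
case/orP => [/eqP/(congr1 val) /(eq_set2 (edge_neq (valP y)))/eqP|].
  exact/negP.
by rewrite negbK => /eqP/setP/(_ x); rewrite !inE eqxx.
Qed.

Lemma adj_avoiding_sym (S : {set G}) : symmetric (adj_avoiding S).
Proof. by move=> x y; rewrite /adj_avoiding /= adj_sym andbCA. Qed.

Lemma k_connected_connected k : 0 < k -> k_connected G k -> connected G.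
Proof.
move=> k0 /andP[kG /forallP/(_ set0)]; rewrite cards0 k0 /= => /forall_inP H.
rewrite /connected (leq_ltn_trans _ kG) //=.
apply/forallP => x; apply/forallP => y.
have /H/forall_inP/(_ y) : x \in ~: set0 by rewrite !inE.
rewrite !inE => /(_ isT); apply: connect_sub => a b.
by rewrite /adj_avoiding /= !inE /= => /connect1.
Qed.

Definition induced_edges (U : {set G}) := [set e in edges G | e \subset U].

Definition partner M x : G := odflt x [pick y | [set x; y] \in M].

Section Partner.
Variables (M : {set {set G}}) (pmM : perfect_matching M).
Notation p := (partner M).

Lemma matching_adj x y : [set x; y] \in M -> adj x y.
Proof. by case/andP: pmM => /subsetP MG _ /MG; rewrite mem_edges. Qed.

Lemma partnerP x : [set x; p x] \in M.
Proof.
rewrite /partner; case: pickP => //= noM.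
case/andP: pmM => /subsetP MG /forallP/(_ x)/cards1P[e /setP/(_ e)].
rewrite !inE eqxx => /andP[eM]; have /edgesP[a [b [_ E]]] := MG _ eM.
move: eM; rewrite E !inE => abM /orP[] /eqP xE; subst x.
  by rewrite noM in abM.
by rewrite setUC noM in abM.
Qed.

Lemma partner_adj x : adj x (p x).
Proof. exact/matching_adj/partnerP. Qed.

Lemma matching_mem x e : e \in M -> x \in e -> e = [set x; p x].
Proof.
move=> eM xe; case/andP: pmM => _ /forallP/(_ x)/cards1P[e' /setP E].
have := E e; rewrite !inE eM xe => /esym/eqP ->.
by have := E [set x; p x]; rewrite !inE partnerP eqxx => /esym/eqP ->.
Qed.

Lemma partner_unique x y : [set x; y] \in M -> y = p x.
Proof.
move=> xyM; have := matching_mem xyM (set21 x y).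
exact/eq_set2/edge_neq/matching_adj.
Qed.

Lemma partnerK : involutive p.
Proof. by move=> x; rewrite -(@partner_unique (p x) x) // setUC partnerP. Qed.

(** The edges of [M] inside [U] partition the vertices matched inside [U] into pairs. *)
Lemma card_matched_inside (U : {set G}) :
  #|[set x in U | p x \in U]| = #|M :&: induced_edges U|.*2.
Proof.
set W := [set x in U | _]; set N := M :&: _.
have inN e : e \in N -> exists2 x, x \in W & e = [set x; p x].
  rewrite !inE => /and3P[eM /edgesP[x [y [_ E]]] eU].
  have xe : x \in e by rewrite E !inE eqxx.
  have E' := matching_mem eM xe; exists x => //.
  by rewrite inE !(subsetP eU) // E' !inE eqxx ?orbT.
have pW : partition N W.
  apply/and3P; split.
  - apply/eqP/setP => x; apply/bigcupP/idP => [[_ /inN[y yW ->]]|xW].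
      move: yW; rewrite !inE => /andP[yU pyU].
      by case/orP => /eqP ->; rewrite ?partnerK yU pyU.
    exists [set x; p x]; last by rewrite !inE eqxx.
    move: xW; rewrite !inE partnerP mem_edges partner_adj /= => /andP[xU pU].
    by apply/subsetP => y; rewrite !inE => /orP[] /eqP ->.
  - apply/trivIsetP => A B; rewrite !inE => /andP[AM _] /andP[BM _].
    apply: contraNT => /pred0Pn[x /andP[xA xB]].
    by rewrite (matching_mem AM xA) (matching_mem BM xB).
  - apply/negP => /inN[x _ /setP/(_ x)]; by rewrite !inE eqxx.
rewrite (card_uniform_partition _ pW (n := 2)) ?muln2 // => _ /inN[x _ ->].
by rewrite cards2 edge_neq ?partner_adj.
Qed.

End Partner.

(** A cut edge has its ends on different sides, and two sides cannot separate three vertices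
    pairwise. *)
Lemma cut_triangle (U : {set G}) x y z :
  [set x; y] \in cut U -> [set x; z] \in cut U -> [set y; z] \in cut U -> False.
Proof.
have mem_cut a b : [set a; b] \in cut U -> (a \in U) != (b \in U).
  rewrite inE mem_edges => /andP[/edge_neq ab]; apply: contraTneq => abU.
  have -> : [set a; b] :&: U = if a \in U then [set a; b] else set0.
    apply/setP => v; rewrite !inE; case: ifP => aU; rewrite !inE.
      by apply: andb_idr => /orP[] /eqP ->; rewrite // -abU.
    by apply/negP => /andP[/orP[] /eqP ->]; rewrite -?abU aU.
  by case: ifP; rewrite ?cards2 ?ab ?cards0.
move=> /mem_cut + /mem_cut + /mem_cut.
by case: (x \in U); case: (y \in U); case: (z \in U).
Qed.

End GraphTheory.

(** * Graphs given by a 1-factorisation: [f c v] is the neighbour of [v] along colour [c] *)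

Section Factorized.
Variables (V T : finType) (f : T -> V -> V).
Hypothesis fK : forall c, involutive (f c).
Hypothesis fN : forall c v, f c v != v.
Hypothesis finj : forall v, injective (f^~ v).

Definition factor_adj : rel V := [rel u v | [exists c, f c u == v]].

Lemma factor_adj_sym : symmetric factor_adj.
Proof. by move=> u v; apply/existsP/existsP => -[c /eqP <-]; exists c; rewrite fK. Qed.

Lemma factor_adj_irrefl : irreflexive factor_adj.
Proof. by move=> u; apply/existsP => -[c]; apply/negP. Qed.

Definition factor_graph := SGraph factor_adj_sym factor_adj_irrefl.
Notation G := factor_graph.

Lemma factor_edgeP (e : {set G}) : e \in edges G ->
  exists c, forall x, x \in e -> e = [set x; f c x].
Proof.
case/edgesP => x [_ [/existsP[c /eqP <-] ->]]; exists c => y.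
by rewrite !inE => /orP[] /eqP ->; rewrite ?fK // setUC.
Qed.

Lemma factor_degree (x : G) : degree x = #|T|.
Proof.
rewrite -(card_imset predT (@finj x)); apply: eq_card => y; rewrite inE.
by apply/existsP/imsetP => [[c /eqP <-]|[c _ ->]]; exists c.
Qed.

Lemma factor_regular : regular G #|T|.
Proof. by apply/forallP => x; rewrite factor_degree. Qed.

Lemma factor_edge_colorable : edge_colorable G #|T|.
Proof.
have /fin_all_exists[c Hc] (e : edge_type G) := factor_edgeP (valP e).
apply/existsP; exists [ffun e => enum_rank (c e)].
apply/forallP => e1; apply/forallP => e2; apply/implyP => /andP[].
rewrite !ffunE (inj_eq enum_rank_inj) => + /set0Pn[x /setIP[x1 x2]].
apply: contraNneq => E; apply/eqP/val_inj => /=.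
by rewrite (Hc _ _ x1) (Hc _ _ x2) E.
Qed.

Lemma factor_class1 : 0 < #|V| -> class1 G.
Proof.
case/card_gt0P => x0 _; rewrite /class1 /edge_chromatic_number.
have -> : max_degree G = #|T|.
  apply/eqP; rewrite eqn_leq; apply/andP; split.
    by apply/bigmax_leqP => x _; rewrite factor_degree.
  by rewrite -(factor_degree x0) /max_degree (leq_bigmax x0).
case: ex_minnP => k /edge_colorable_degree kG kmin.
by rewrite eqn_leq kmin ?factor_edge_colorable // -(factor_degree x0) kG.
Qed.

Lemma factor_matching c : perfect_matching (G := G) [set [set x; f c x] | x : G].
Proof.
apply/andP; split.
  apply/subsetP => _ /imsetP[x _ ->]; rewrite mem_edges.
  by apply/existsP; exists c.
apply/forallP => x; apply/cards1P; exists [set x; f c x].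
apply/setP => e; rewrite !inE; apply/andP/eqP => [[/imsetP[y _ ->]]|->].
  by rewrite !inE => /orP[] /eqP ->; rewrite ?fK // setUC.
by rewrite !inE eqxx; split=> //; apply/imsetP; exists x.
Qed.

Lemma factor_matching_covered : connected G -> matching_covered G.
Proof.
move=> cG; rewrite /matching_covered cG; apply/forall_inP => e eG.
apply/existsP; have [c ce] := factor_edgeP eG.
exists [set [set x; f c x] | x : G]; rewrite factor_matching /=.
case/edgesP: eG => x [y [_ E]]; apply/imsetP; exists x => //.
by apply: ce; rewrite E !inE eqxx.
Qed.

End Factorized.

(** * The ring of cliques: construction, perfect matchings and a non-feasible set *)

Section Necklace.
Variables (p q : nat) (b : bool).
Hypotheses (p_odd : odd p) (p_ge3 : 2 < p) (le_pq : p <= q).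
Local Open Scope ring_scope.
Notation Zm := 'I_p.+2.
Notation Zn := 'I_q.+2.

(* [(i, Some x)] is the vertex [x] of the [i]-th clique, [(t, None)] the [t]-th
   extra point. *)
Definition vtx : finType := (Zn * option Zm)%type.

Definition ok (c : Zm) : bool := ~~ (b && (c == 2%:R)).

Lemma ok_neq2 c : c != 2%:R -> ok c.
Proof. by rewrite /ok => /negPf ->; rewrite andbF. Qed.

Definition color := {c : Zm | ok c}.

(* [m = p.+2] is odd, so [m.+1./2] is the inverse of 2 modulo [m]. *)
Definition half (c : Zm) : Zm := c *+ (p.+3)./2.

(** Not additive, but injective since [p <= q]. *)
Definition place (x : Zm) : Zn := (nat_of_ord x)%:R.

(** The neighbour along colour [c]: inside a clique [x] goes to [c - x], and the fixed point of this
    reflection goes to an extra point instead. *)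
Definition move_along (c : Zm) (v : vtx) : vtx :=
  match v.2 with
  | Some x => if c - x == x then (v.1 + place x, None) else (v.1, Some (c - x))
  | None => (v.1 - place (half c), Some (half c))
  end.

Lemma natr_Zm k : (k < p.+2)%N -> nat_of_ord (k%:R : Zm) = k.
Proof. by move=> kp; rewrite Zp_nat /= modn_small. Qed.

Lemma eq_natr_Zm k l : (k < p.+2)%N -> (l < p.+2)%N ->
  (k%:R == l%:R :> Zm) = (k == l).
Proof. by move=> kp lp; rewrite -val_eqE /= !natr_Zm. Qed.

Lemma place_natr k : (k < p.+2)%N -> place k%:R = k%:R.
Proof. by move=> kp; rewrite /place natr_Zm. Qed.

Lemma place_inj : injective place.
Proof.
move=> x y /(congr1 val); rewrite /place !Zp_nat /= !modn_small; first exact: val_inj.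
  by rewrite (leq_trans (ltn_ord y)).
by rewrite (leq_trans (ltn_ord x)).
Qed.

Lemma double_half c : half c + half c = c.
Proof.
rewrite -mulr2n -mulrnA muln2 halfK /= p_odd subn0 mulrS -mulr_natr Zp_nat.
suff -> : inZp p.+2 = 0 :> Zm by rewrite mulr0 addr0.
by apply: val_inj; rewrite /= modnn.
Qed.

Lemma half_double x : half (x + x) = x.
Proof. by rewrite /half mulrnDl -/(half x) double_half. Qed.

(** As 2 is invertible, each colour sends exactly one vertex of a clique to an extra point. *)
Lemma sub_eq_half c x : (c - x == x) = (x == half c).
Proof.
rewrite subr_eq; apply/eqP/eqP => ->; by rewrite ?half_double ?double_half.
Qed.

Lemma move_alongK c : involutive (move_along c).
Proof.
move=> [i [x|]]; rewrite /move_along /=; last first.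
  by rewrite sub_eq_half eqxx subrK.
case: ifP => cx /=.
  by move: cx; rewrite sub_eq_half => /eqP <-; rewrite addrK.
by rewrite subKr eq_sym cx.
Qed.

Lemma move_along_neq c v : move_along c v != v.
Proof.
case: v => [i [x|]]; rewrite /move_along /=; last by rewrite xpair_eqE andbF.
by case: ifPn => cx; rewrite xpair_eqE ?andbF // (inj_eq Some_inj) (negPf cx) andbF.
Qed.

Lemma move_along_inj v : injective (move_along^~ v).
Proof.
case: v => [i [x|]] c d; rewrite /move_along /=; last first.
  move=> /(congr1 (fun w : vtx => odflt 0 w.2)) /= E.
  by rewrite -(double_half c) E double_half.
case: ifP => cx; case: ifP => dx //.
  by move/eqP: cx => /(canRL (subrK _)) ->; move/eqP: dx => /(canRL (subrK _)) ->.
by move=> /(congr1 (fun w : vtx => odflt 0 w.2)) /addIr.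
Qed.

Definition necklace : sgraph :=
  factor_graph (f := fun c : color => move_along (val c))
    (fun c => move_alongK (val c)) (fun c v => move_along_neq (val c) v).
Notation H := necklace.

Lemma color_inj v : injective (fun c : color => move_along (val c) v).
Proof. by move=> c d /move_along_inj/val_inj. Qed.

Lemma card_color : #|{: color}| = (p.+2 - b)%N.
Proof.
rewrite card_sig -[in RHS](card_ord p.+2); rewrite /ok; case: b => /=.
  by rewrite [in RHS](cardD1 (2%:R : Zm)) /= addKn; apply: eq_card => c; rewrite !inE andbT.
by rewrite subn0; apply: eq_card.
Qed.

Lemma adjKK i x y : x != y -> ok (x + y) -> @adj H (i, Some x) (i, Some y).
Proof.
move=> xy okxy; apply/existsP; exists (Sub (x + y) okxy).
by rewrite /move_along /= addrC addKr (eq_sym y) (negPf xy).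
Qed.

Lemma adjKN i x : ok (x + x) -> @adj H (i, Some x) (i + place x, None).
Proof.
move=> okxy; apply/existsP; exists (Sub (x + x) okxy).
by rewrite /move_along /= addrK eqxx.
Qed.

Lemma adj_copy (u v : H) : adj u v ->
  match u.2, v.2 with
  | Some _, Some _ => u.1 = v.1
  | None, None => False
  | _, _ => True
  end.
Proof.
case: u => [i ox] /existsP[c /eqP <-] /=; rewrite /move_along /=.
by case: ox => //= x; case: ifP.
Qed.

Definition clique i : {set H} := [set v | (v.1 == i) && isSome v.2].

Lemma card_clique i : #|clique i| = p.+2.
Proof.
rewrite -[RHS]card_ord -(card_imset predT (f := fun x : Zm => (i, Some x) : H)).
  apply: eq_card => -[j [x|]]; rewrite inE /=; apply/andP/imsetP => /=.
  - by case=> /eqP -> _; exists x.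
  - by case=> y _ [-> _].
  - by case.
  - by case.
by move=> x y [].
Qed.

(** By parity every odd clique has a vertex matched to an extra point. There are as many extra
    points as cliques, so each clique has exactly one such vertex. *)
Lemma card_matching_clique M i : perfect_matching M ->
  #|M :&: induced_edges (clique i)|.*2.+1 = p.+2.
Proof.
move=> pmM; rewrite -(card_matched_inside pmM).
pose out i := [set v in clique i | ~~ isSome (partner M v).2].
have inout j : (#|[set v in clique j | partner M v \in clique j]| + #|out j| = p.+2)%N.
  rewrite -(card_clique j) -[RHS](cardsID [set v | isSome (partner M v).2]).
  congr (_ + _)%N; apply: eq_card => -[k [x|]]; rewrite !inE /= ?andbF //;
    have := adj_copy (partner_adj pmM (k, Some x)); case: (partner M _) => l [y|] //= kl;
    by rewrite ?kl ?andbT ?andbF //; case: eqP.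
have out_gt0 j : (0 < #|out j|)%N.
  have := congr1 odd (inout j); rewrite oddD card_matched_inside // odd_double /=.
  by rewrite p_odd; case: #|_|.
(* Extra points are pairwise non-adjacent, so [partner M] maps them bijectively onto the union of
   the sets [out j]. *)
have sum_out : (\sum_j #|out j| = q.+2)%N.
  rewrite -[RHS]card_ord -(card_imset predT (f := fun i : Zn => partner M ((i, None) : H))).
    rewrite -sum1_card (partition_big (fun v : H => v.1) predT) //=.
    apply: eq_bigr => j _; rewrite -sum1_card; apply: eq_bigl => v.
    rewrite !inE; apply/andP/andP => [[/andP[/eqP -> sv] nv]|[/imsetP[k _ ->] /eqP ->]].
      split=> //; apply/imsetP; exists (partner M v).1 => //.
      rewrite -[LHS](partnerK pmM).
      by case: (partner M v) nv => k [].
    rewrite partnerK // eqxx /=; split=> //.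
    have := adj_copy (partner_adj pmM (k, None)).
    by case: (partner M _) => l [].
  by move=> k l /(can_inj (partnerK pmM)) [].
suff out1 : #|out i| = 1%N by have := inout i; rewrite out1 addn1.
apply/eqP; rewrite eqn_leq out_gt0 andbT leqNgt; apply/negP => out2.
suff : (\sum_(j < q.+2) 1 < \sum_(j < q.+2) #|out j|)%N.
  by rewrite sum_out sum_nat_const card_ord muln1 ltnn.
rewrite (bigD1 i) //= [X in (_ < X)%N](bigD1 i) //= -addSn.
by rewrite leq_add // leq_sum.
Qed.

Lemma clique_triangle i : exists x y z : H,
  [/\ adj x y, adj x z & adj y z] /\ {subset [set x; y; z] <= clique i}.
Proof.
have lt3 : (3 < p.+2)%N by rewrite ltnS ltnW.
(* The sums 1, 3 and 4 differ from 2 modulo [p.+2 >= 5], so these edges survive when colour 2 is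
   dropped. *)
exists (i, Some 0%:R), (i, Some 1%:R), (i, Some 3%:R); split.
  have lt2 := ltnW lt3; have lt1 := ltnW lt2; have lt0 := ltnW lt1.
  have lt4 : (4 < p.+2)%N by rewrite !ltnS.
  by split; apply: adjKK; rewrite ?ok_neq2 -?natrD ?eq_natr_Zm.
by move=> v; rewrite !inE => /orP[/orP[]|] /eqP -> /=; rewrite eqxx.
Qed.

Lemma necklace_Nstar : Nstar H != set0.
Proof.
apply/set0Pn; exists (induced_edges (clique 0)); rewrite inE.
have edge_in i (x y z u v : H) : {subset [set x; y; z] <= clique i} ->
    u \in [set x; y; z] -> v \in [set x; y; z] -> adj u v ->
    [set u; v] \in induced_edges (clique i).
  move=> sub uT vT uv; rewrite inE mem_edges uv; apply/subsetP => w.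
  by rewrite in_set2 => /orP[] /eqP ->; apply: sub.
apply/and4P; split.
- by apply/subsetP => e; rewrite inE => /andP[].
- apply/existsP => -[M1 /existsP[M2 /and3P[pm1 pm2]]].
  have := card_matching_clique 0 pm1; rewrite -(card_matching_clique 0 pm2).
  by case=> /double_inj ->; rewrite eqxx.
- apply/existsP => -[U /eqP XE].
  have XU : induced_edges (clique 0) = cut U.
    by rewrite XE /symdiff set0D setD0 set0U.
  have [x [y [z [[xy xz yz] sub]]]] := clique_triangle 0.
  by apply: (@cut_triangle _ U x y z); rewrite -XU;
    apply: (edge_in _ x y z); rewrite // !inE eqxx ?orbT.
- apply/existsP => -[U /eqP XE].
  (* The complement of the edge set of clique 0 would be a cut, yet it contains the triangles of
     clique 1. *)
  have [x [y [z [[xy xz yz] sub]]]] := clique_triangle 1.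
  have in_cut u v : u \in [set x; y; z] -> v \in [set x; y; z] -> adj u v ->
      [set u; v] \in cut U.
    move=> uT vT uv; have := edge_in _ _ _ _ _ _ sub uT vT uv.
    rewrite inE => /andP[eG eK1].
    have : [set u; v] \notin induced_edges (clique 0).
      rewrite inE eG /=; apply/negP => /subsetP/(_ u (set21 _ _)).
      by have := subsetP eK1 u (set21 _ _); rewrite !inE => /andP[/eqP -> _].
    by rewrite XE /symdiff in_setU !in_setD eG andbT orbF negbK.
  by apply: (@cut_triangle _ U x y z); apply: in_cut; rewrite // !inE eqxx ?orbT.
Qed.

(** * 4-connectivity: paths that avoid a set of at most three vertices *)

Section Connectivity.
Variable S : {set H}.
Hypothesis S3 : (#|S| <= 3)%N.
Notation con := (connect (adj_avoiding S)).

Lemma con_sym : symmetric con.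
Proof.
exact/sym_connect_sym/adj_avoiding_sym.
Qed.

Lemma con1 (u v : H) : u \notin S -> v \notin S -> adj u v -> con u v.
Proof. by move=> uS vS uv; apply/connect1/and3P. Qed.

Definition loc (v : H) : Zn := if v.2 is Some x then v.1 + place x else v.1.

Definition clean t := t \notin loc @: S.

Lemma clean_notin (v : H) : clean (loc v) -> v \notin S.
Proof. by apply: contra => vS; apply: imset_f. Qed.

(** Each vertex of [S] spoils only its own place, so at most three of the distinct places [g x] are
    lost. *)
Lemma clean_card (T : finType) (A : {set T}) (g : T -> Zn) :
  {in A &, injective g} -> (#|A| - 3 <= #|[set x in A | clean (g x)]|)%N.
Proof.
move=> ginj; rewrite leq_subLR -(cardsID [set x | clean (g x)] A) addnC.
rewrite setIdE leq_add2r; apply: leq_trans S3.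
apply: leq_trans (leq_imset_card loc S).
rewrite -(card_in_imset (f := g)); last first.
  by move=> x y /setDP[xA _] /setDP[yA _]; apply: ginj.
apply/subset_leq_card/subsetP => _ /imsetP[x /setDP[_ + ] ->].
by rewrite inE negbK.
Qed.

Lemma con_center i x : clean (i + place x) -> ok (x + x) ->
  con (i, Some x) (i + place x, None).
Proof.
by move=> ci okx; apply: con1; [exact: clean_notin | exact: clean_notin | exact: adjKN].
Qed.

(** The path runs through the vertices [k] and [l] of clique [t - k]; all of it lies at the two
    clean places. *)
Lemma con_pair k l t : (k < p.+2)%N -> (l < p.+2)%N -> k%:R != l%:R :> Zm ->
  ok (k%:R + k%:R) -> ok (l%:R + l%:R) -> ok (k%:R + l%:R) ->
  clean t -> clean (t + l%:R - k%:R) ->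
  con (t, None) (t + l%:R - k%:R, None).
Proof.
move=> kp lp kl okk okl okkl; pose i := t - k%:R.
have -> : t = i + place k%:R by rewrite place_natr // subrK.
have -> : i + place k%:R + l%:R - k%:R = i + place l%:R.
  by rewrite !place_natr // addrAC addrK.
move=> ct ctd; apply: connect_trans (con_center ctd okl).
rewrite con_sym; apply: connect_trans (con_center ct okk).
rewrite con_sym; apply: con1; try exact: clean_notin.
exact: adjKK.
Qed.

Lemma ok_natr2 k : (k < p.+2)%N -> k != 1%N -> ok (k%:R + k%:R).
Proof.
move=> kp k1; apply: ok_neq2; apply: contra k1 => /eqP E.
have := congr1 half E; rewrite half_double -[2%:R]/(1%:R + 1%:R) half_double.
by move/eqP; rewrite eq_natr_Zm.
Qed.

Lemma con_step t d : (0 < d <= 4)%N -> clean t -> clean (t + d%:R) ->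
  con (t, None) (t + d%:R, None).
Proof.
have lt3 : (3 < p.+2)%N by rewrite ltnS ltnW.
have lt2 := ltnW lt3; have lt1 := ltnW lt2; have lt0 := ltnW lt1.
have lt4 : (4 < p.+2)%N by rewrite !ltnS.
(* Vertex 1 is avoided because its edge to an extra point has colour 2, which may be missing. *)
have main k l : (k < p.+2)%N -> (l < p.+2)%N -> k != 1%N -> l != 1%N ->
    (k < l)%N -> ok (k%:R + l%:R) -> d = (l - k)%N -> clean t ->
    clean (t + d%:R) -> con (t, None) (t + d%:R, None).
  move=> kp lp k1 l1 kl okl ->; rewrite natrB ?(ltnW kl) // addrA => ct ctd.
  by apply: con_pair; rewrite ?ok_natr2 ?eq_natr_Zm ?(ltn_eqF kl).
have n2 k : (0 < k < p.+2)%N -> ok (2%:R + k%:R).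
  case/andP=> k0 kp; apply: ok_neq2; rewrite -subr_eq0 addrAC subrr add0r.
  by rewrite (eq_natr_Zm (l := 0)) // -lt0n.
case: d main => [|[|[|[|[|d]]]]] main //= _.
- by apply: (main 2 3)%N; rewrite ?n2.
- by apply: (main 2 4)%N; rewrite ?n2.
- by apply: (main 0 3)%N; rewrite // add0r ok_neq2 ?eq_natr_Zm.
- by apply: (main 0 4)%N; rewrite // add0r ok_neq2 ?eq_natr_Zm.
Qed.

(** Strong induction on [k]: beyond distance 4, one of the four places just before [t + k] is clean,
    and a single step leads from it to [t + k]. *)
Lemma con_clean_shift t k : clean t -> clean (t + k%:R) ->
  con (t, None) (t + k%:R, None).
Proof.
move=> ct; elim/ltn_ind: k => k IH ck.
case: (posnP k) => [->|k0]; first by rewrite addr0.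
have [k4|k4] := leqP k 4; first by apply: con_step; rewrite ?k0.
have ginj : {in [set: 'I_4] &, injective (fun d : 'I_4 => t + (k - d.+1)%:R : Zn)}.
  have lt5 (d : 'I_4) : (d.+1 < q.+2)%N.
    by rewrite ltnS (leq_trans (ltn_ord d)) // ltnS (leq_trans p_ge3).
  have lek (d : 'I_4) : (d.+1 <= k)%N := leq_trans (ltn_ord d) (ltnW k4).
  move=> d e _ _ /addrI; rewrite !natrB // => /addrI/oppr_inj/(congr1 val).
  by rewrite !Zp_nat /= !modn_small // => -[/val_inj].
have := clean_card ginj; rewrite cardsT card_ord => /card_gt0P[d].
rewrite !inE /= => cd.
have dk : (d.+1 <= k)%N by apply: leq_trans (ltnW k4); exact: ltn_ord.
apply: connect_trans (IH _ _ cd) _; first by rewrite ltn_subrL k0.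
have -> : t + k%:R = t + (k - d.+1)%:R + d.+1%:R by rewrite -addrA -natrD subnK.
by apply: con_step; rewrite // -?addrA -?natrD ?subnK //= ltn_ord.
Qed.

Lemma con_clean t t' : clean t -> clean t' -> con (t, None) (t', None).
Proof.
have -> : t' = t + (val (t' - t))%:R by rewrite natr_Zp addrC subrK.
exact: con_clean_shift.
Qed.

Lemma con_to_clean (v : H) : (3 < p.+2 - b)%N -> v \notin S ->
  exists2 t, clean t & con v (t, None).
Proof.
move=> r4.
have conSome i x : (i, Some x) \notin S -> exists2 t, clean t & con (i, Some x) (t, None).
  move=> xS.
  pose Q := [set x in [set: Zm] | clean (i + place x)].
  (* The clique has [p.+2 >= 5] vertices at distinct places, and at most three of these places are
     spoiled. *)
  have : (1 < #|Q|)%N.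
    apply: leq_trans (clean_card _); first by rewrite cardsT card_ord ltn_subRL !ltnS.
    by move=> y z _ _ /addrI/place_inj.
  case/card_gt1P => y [z]; rewrite !inE /= => -[cy cz yz].
  have alive w : clean (i + place w) -> (i, Some w) \notin S.
    by move=> cw; apply: clean_notin.
  have conK u w : (i, Some u) \notin S -> (i, Some w) \notin S -> ok (u + w) ->
      con (i, Some u) (i, Some w).
    move=> uS wS uw; have [->//|nuw] := eqVneq u w.
    exact/con1/adjKK.
  have exit w : clean (i + place w) -> ok (w + w) -> con (i, Some x) (i, Some w) ->
      exists2 t, clean t & con (i, Some x) (t, None).
    move=> cw okw xw; exists (i + place w) => //.
    exact: connect_trans xw (con_center cw okw).
  have ok2 w : w != 1 -> ok (w + w).
    move=> w1; apply/ok_neq2; apply: contra w1 => /eqP/(congr1 half).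
    by rewrite half_double -[2%:R]/(1 + 1) half_double => ->.
  have ok1 w : w != 1 -> ok (1 + w).
    by move=> w1; apply/ok_neq2; rewrite -[2%:R]/(1 + 1) (inj_eq (addrI 1)).
  (* If the place of vertex 1 is clean, 1 serves as a hub: since [1 + w] is not 2 for [w != 1], it
     is adjacent to the rest of its clique. *)
  have [c1|d1] := boolP (clean (i + place 1)).
    have [w cw w1] : exists2 w, clean (i + place w) & w != 1.
      have [y1|y1] := eqVneq y 1; last by exists y.
      by exists z; rewrite // -y1 eq_sym.
    apply: (exit w); rewrite ?ok2 //.
    have x1w : con (i, Some 1) (i, Some w) by apply: conK; rewrite ?alive ?ok1.
    have [->//|x1] := eqVneq x 1.
    apply: connect_trans x1w; rewrite con_sym.
    by apply: conK; [apply: alive | | apply: ok1].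
  have y1 : y != 1 by apply: contraNneq d1 => <-.
  have z1 : z != 1 by apply: contraNneq d1 => <-.
  (* At most one of [x + y] and [x + z] is the colour 2, so [x] reaches [y] or [z]. *)
  have [xy|xy] := eqVneq (x + y) 2%:R.
    apply: (exit z); rewrite ?ok2 //; apply: conK => //; first exact: alive.
    by apply: ok_neq2; rewrite -xy (inj_eq (addrI x)) eq_sym.
  by apply: (exit y); rewrite ?ok2 //; apply: conK; rewrite ?ok_neq2 //; apply: alive.
case: v => t [x|]; first exact: conSome.
move=> tS.
(* An extra point has more than three neighbours, one per colour, so one of them escapes [S]. *)
have [c cS] : exists c : color, move_along (val c) (t, None) \notin S.
  apply/existsP; rewrite -negb_forall; apply/negP => /forallP allS.
  have : (#|{: color}| <= #|S|)%N.
    rewrite -(card_imset predT (@color_inj (t, None))).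
    by apply/subset_leq_card/subsetP => _ /imsetP[c _ ->].
  by rewrite card_color leqNgt (leq_ltn_trans S3).
have tc : @adj H (t, None) (move_along (val c) (t, None)) by apply/existsP; exists c.
have [t' ct' con'] := conSome _ _ cS.
by exists t' => //; apply: connect_trans con'; apply: con1.
Qed.

End Connectivity.

Lemma necklace_k_connected : (3 < p.+2 - b)%N -> k_connected H 4.
Proof.
move=> r4; apply/andP; split.
  rewrite card_prod card_option !card_ord.
  by apply: (@leq_trans p.+3); rewrite ?leq_pmull // !ltnS ltnW.
apply/forallP => S; apply/implyP => S3.
apply/forall_inP => x; rewrite inE => xS; apply/forall_inP => y; rewrite inE => yS.
have [t ct xt] := con_to_clean S3 r4 xS.
have [t' ct' yt'] := con_to_clean S3 r4 yS.
apply: connect_trans xt (connect_trans (con_clean S3 ct ct') _).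
by rewrite con_sym.
Qed.

Lemma necklaceP : (3 < p.+2 - b)%N ->
  [/\ k_connected H 4, regular H (p.+2 - b), class1 H,
      matching_covered H & Nstar H != set0].
Proof.
move=> r4; have k4 := necklace_k_connected r4.
rewrite -card_color; split => //.
- exact/factor_regular/color_inj.
- apply: factor_class1; first exact: color_inj.
  by apply/card_gt0P; exists (0, None).
- by apply: factor_matching_covered; apply: k_connected_connected k4.
- exact: necklace_Nstar.
Qed.

End Necklace.

(** * Choice of the parameters and the infinite family *)

Theorem theorem5p5 (r : nat) (hr : 4 <= r) :
  exists H : nat -> sgraph,
    (forall i j : nat, i <> j -> ~ isomorphic (H i) (H j)) /\
    (forall i : nat,
       [/\ k_connected (H i) 4, regular (H i) r, class1 (H i),
           matching_covered (H i) & Nstar (H i) != set0]).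
Proof.
(* With these values [p.+2] is the odd one of [r] and [r + 1], and colour 2 is dropped exactly when
   [r] is even. *)
pose b := ~~ odd r; pose p := r - 2 + b.
have r2 : 2 <= r by apply: leq_trans hr.
have p_odd : odd p by rewrite /p /b oddD oddB // addbF oddb addbN addbb.
have p_ge3 : 2 < p.
  have [r4|r4|r4] := ltngtP r 4; first by rewrite leqNgt r4 in hr.
    by rewrite (leq_trans _ (leq_addr _ _)) // ltn_subRL.
  by rewrite /p /b r4.
have pr : p.+2 - b = r by rewrite /p -addn2 addnAC subnK // addnK.
(* The [i]-th graph has [p + i + 2] cliques, so different indices give different numbers of
   vertices. *)
exists (fun i => necklace (p + i) b p_odd); split=> [i j ij [f /bij_eq_card]|i].
  rewrite !card_prod !card_option !card_ord => /eqP.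
  by rewrite eqn_pmul2r // !eqSS eqn_add2l => /eqP.
by rewrite -[in regular _ _]pr; apply: necklaceP; rewrite ?leq_addr ?pr.
Qed.
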